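(* Let $n\ge 2$ and let $\Omega_1,\Omega_2\subset\mathbb{R}^n$ be regions with Blum medial axes $M_1,M_2$. For $i=1,2$ suppose that $M_i$ contains a smooth branching submanifold $\Gamma_i$ of codimension $2$ in $\mathbb{R}^n$ along which four smooth (codimension one in $\mathbb{R}^n$) medial sheets $S^{(i)}_1,\dots,S^{(i)}_4\subset M_i$ meet, in such a way that for every $x\in\Gamma_i$ each sheet $S^{(i)}_j$ has a unique limiting tangent hyperplane $T_xS^{(i)}_j$ at $x$, one has $T_x\Gamma_i\subset T_xS^{(i)}_j$ for $j=1,\dots,4$, and the four hyperplanes $T_xS^{(i)}_1,\dots,T_xS^{(i)}_4$ are distinct. Let $\chi_i:\Gamma_i\to\mathbb{RP}^1/\mathcal{S}_3$ be the cross ratio map of $\Gamma_i$, sending $x\in\Gamma_i$ to the set of cross ratio values of the four hyperplanes $T_xS^{(i)}_1,\dots,T_xS^{(i)}_4$. Suppose there is a diffeomorphism $\varphi$ from a neighborhood of $\Gamma_1$ in $\mathbb{R}^n$ onto a neighborhood of $\Gamma_2$ in $\mathbb{R}^n$ which sends $\Gamma_1$ to $\Gamma_2$ and sends the sheet $S^{(1)}_j$ to the sheet $S^{(2)}_j$ (within these neighborhoods) for $j=1,\dots,4$. Then $$\chi_2\circ\varphi=\chi_1\quad\text{on }\Gamma_1 .$$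
   Context: The Blum medial axis of a region $\Omega\subset\mathbb{R}^n$ (with piecewise smooth boundary) is the closure of the set of points of $\Omega$ having at least two closest points on the boundary. Limiting tangent hyperplane: if $S$ is a smooth hypersurface with $\Gamma$ in its closure and $x\in\Gamma$, then $S$ has a unique limiting tangent hyperplane $T_xS$ at $x$ if for all sequences $x_k\in S$ with $x_k\to x$ the tangent hyperplanes $T_{x_k}S$ converge to the same hyperplane, denoted $T_xS$. Cross ratio of points: for four distinct points $z_1,\dots,z_4$ of a projective line, $$R(z_1,\dots,z_4)=\frac{(z_1-z_4)(z_3-z_2)}{(z_1-z_2)(z_3-z_4)},$$ extended by limits if some $z_i=\infty$. Lines through the origin in a $2$-dimensional real vector space are points of a real projective line, so four distinct ordered lines have a cross ratio; in $\mathbb{R}^2$, if the lines are $y=a_ix$, the cross ratio is $R(a_1,a_2,a_3,a_4)$. It is invariant under invertible linear maps. Cross ratio of hyperplanes: if $H_1,\dots,H_4\subset\mathbb{R}^n$ are distinct linear hyperplanes all containing a codimension $2$ subspace $L$, their cross ratio is that of the four lines $H_i\cap\Pi$ in any plane $\Pi$ through the origin transverse to $L$; it does not depend on $\Pi$. Set of cross ratio values: permuting the four ordered objects replaces the cross ratio $\lambda$ by one of $$\lambda,\ \tfrac1\lambda,\ 1-\lambda,\ \tfrac1{1-\lambda},\ \tfrac{\lambda-1}{\lambda},\ \tfrac{\lambda}{\lambda-1},$$ the orbit of $\lambda$ under the group isomorphic to $\mathcal{S}_3$ generated by $\lambda\mapsto 1/\lambda$ and $\lambda\mapsto 1-\lambda$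 acting on $\mathbb{RP}^1$. The quotient $\mathbb{RP}^1/\mathcal{S}_3$ is the set of such orbits; a point of it is a set of corresponding cross ratio values. *)

(* Defs.v *)
From HB Require Import structures.
From mathcomp Require Export all_boot all_order all_algebra.
From mathcomp Require Export all_classical all_reals all_analysis.
Export numFieldNormedType.Exports.
Export Order.TTheory GRing.Theory Num.Theory.

Set Implicit Arguments.
Unset Strict Implicit.
Unset Printing Implicit Defensive.

Local Open Scope classical_set_scope.
Local Open Scope ring_scope.

Section Smooth.
Context {R : realType}.

(* Differentiability is required at every point of the open set U, so the
   total function 'D_v f is the genuine derivative there; its values outside U
   are irrelevant. *)
Fixpoint Ck_on (k : nat) (V W : normedModType R) (U : set V) (f : V -> W) :
    Prop :=
  match k with
  | 0 => forall x, U x -> {for x, continuous f}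
  | k'.+1 => (forall x, U x -> differentiable f x) /\
             (forall v : V, Ck_on k' U (fun x => 'D_v f x))
  end.

Definition smooth_on (V W : normedModType R) (U : set V) (f : V -> W) : Prop :=
  forall k, Ck_on k U f.

Definition diffeomorphism (V W : normedModType R) (U : set V) (U' : set W)
    (f : V -> W) : Prop :=
  [/\ open U, open U', smooth_on U f &
      exists g : W -> V, [/\ smooth_on U' g,
        (forall x, U x -> U' (f x) /\ g (f x) = x) &
        (forall y, U' y -> U (g y) /\ f (g y) = y)]].

End Smooth.

Section Submanifolds.
Context {R : realType} {n : nat}.
Implicit Types (S G : set 'rV[R]_n) (x v : 'rV[R]_n).

(* Embedded submanifold without boundary: near each of its points, S is
   straightened by a diffeomorphism onto the vanishing locus of the last c
   coordinates. *)
Definition submanifold (c : nat) S : Prop :=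
  forall x, S x -> exists U V (h : 'rV[R]_n -> 'rV[R]_n),
    [/\ U x, diffeomorphism U V h &
        forall y, U y ->
          (S y <-> forall i : 'I_n, (n - c <= i)%N -> h y 0 i = 0)].

Definition tangent_space S x : set 'rV[R]_n :=
  [set v | exists2 e : R, 0 < e & exists gamma : R -> 'rV[R]_n,
    [/\ smooth_on `]- e, e[%classic gamma,
        (forall t, `]- e, e[%classic t -> S (gamma t)),
        gamma 0 = x &
        derive1 gamma 0 = v]].

Definition normal_to (H : set 'rV[R]_n) (u : 'cV[R]_n) : Prop :=
  u != 0 /\ H = [set v | v *m u = 0].

(* Convergence in the space of hyperplanes, i.e. in the projectivization of the
   dual space with its quotient topology. *)
Definition hyperplane_cvg (H_ : nat -> set 'rV[R]_n) (H : set 'rV[R]_n) :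
    Prop :=
  exists (u_ : nat -> 'cV[R]_n) (u : 'cV[R]_n),
    [/\ forall k, normal_to (H_ k) (u_ k), normal_to H u &
        u_ k @[k --> \oo] --> u].

Definition is_limiting_tangent S x (H : {vspace 'rV[R]_n}) : Prop :=
  forall x_ : nat -> 'rV[R]_n, (forall k, S (x_ k)) ->
    x_ k @[k --> \oo] --> x ->
    hyperplane_cvg (fun k => tangent_space S (x_ k)) [set` H].

Definition has_limiting_tangent S x : Prop :=
  closure S x /\ exists! H, is_limiting_tangent S x H.

(* The hyperplane T_x S, meaningful when [has_limiting_tangent S x]. *)
Definition limiting_tangent S x : {vspace 'rV[R]_n} :=
  xget 0%VS (is_limiting_tangent S x).

End Submanifolds.

Section MedialAxis.
Context {R : realType} {n : nat}.
Implicit Types (Omega B : set 'rV[R]_n) (x y : 'rV[R]_n).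

(* The library norm on 'rV_n is the supremum norm, which gives the right
   topology but not the right distance. *)
Definition euclidean_dist x y : R :=
  Num.sqrt (\sum_(i < n) (x 0 i - y 0 i) ^+ 2).

Definition boundary Omega : set 'rV[R]_n := closure Omega `\` interior Omega.

Definition closest_point B x y : Prop :=
  B y /\ forall z, B z -> euclidean_dist x y <= euclidean_dist x z.

Definition medial_axis Omega : set 'rV[R]_n :=
  closure [set x | Omega x /\ exists y z,
    [/\ y <> z, closest_point (boundary Omega) x y &
        closest_point (boundary Omega) x z]].

(* The boundary is a locally finite disjoint union of smooth submanifolds of
   positive codimension, the hypersurface pieces being dense in it. *)
Definition piecewise_smooth B : Prop :=
  exists P : set (set 'rV[R]_n),
    [/\ B = \bigcup_(A in P) A,
        trivIset P id,
        (forall A, P A -> exists2 c, (0 < c <= n)%N & submanifold c A),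
        (forall x, exists2 U, nbhs x U &
           finite_set [set A | P A /\ A `&` U !=set0]) &
        B `<=` closure (\bigcup_(A in [set A | P A /\ submanifold 1 A]) A)].

(* Neither openness nor closedness, boundedness or connectedness is imposed. *)
Definition region Omega : Prop :=
  [/\ Omega !=set0, Omega `<=` closure (interior Omega) &
      piecewise_smooth (boundary Omega)].

End MedialAxis.

Section CrossRatio.
Context {R : realType}.

(* The real projective line, [None] being the point at infinity. *)
Definition RP1 : Type := option R.

(* Meaningful for distinct points: at most one of them is then infinite, and
   the value is finite. *)
Definition cross_ratio (z1 z2 z3 z4 : RP1) : RP1 :=
  match z1, z2, z3, z4 with
  | Some a1, Some a2, Some a3, Some a4 =>
      Some (((a1 - a4) * (a3 - a2)) / ((a1 - a2) * (a3 - a4)))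
  | None, Some a2, Some a3, Some a4 => Some ((a3 - a2) / (a3 - a4))
  | Some a1, None, Some a3, Some a4 => Some ((a1 - a4) / (a3 - a4))
  | Some a1, Some a2, None, Some a4 => Some ((a1 - a4) / (a1 - a2))
  | Some a1, Some a2, Some a3, None => Some ((a3 - a2) / (a1 - a2))
  | _, _, _, _ => None
  end.

Definition RP1_inv (l : RP1) : RP1 :=
  if l is Some a then if a == 0 then None else Some a^-1 else Some 0.

Definition RP1_1sub (l : RP1) : RP1 :=
  if l is Some a then Some (1 - a) else None.

(* The last two values are 1 - 1/l = (l - 1)/l and 1/(1 - 1/l) = l/(l - 1). *)
Definition S3_orbit (l : RP1) : set RP1 :=
  [set m | m \in [:: l; RP1_inv l; RP1_1sub l; RP1_inv (RP1_1sub l);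
                     RP1_1sub (RP1_inv l); RP1_inv (RP1_1sub (RP1_inv l))]].

(* RP1 / S3 *)
Definition RP1_S3 : Type := {O : set RP1 | exists l, O = S3_orbit l}.

Definition S3_class (l : RP1) : RP1_S3 := exist _ (S3_orbit l) (ex_intro _ l erefl).

Context {n : nat}.
Implicit Types (D Pi L : {vspace 'rV[R]_n}) (H : 'I_4 -> {vspace 'rV[R]_n}).

(* The point of the projective line given by a line D of the plane with basis
   (e1, e2), namely the slope a of D = { t e1 + a t e2 }. *)
Definition slope (e1 e2 : 'rV[R]_n) D : RP1 :=
  if e2 \in D then None else Some (xget 0 [set a | e1 + a *: e2 \in D]).

(* By linear invariance the choice of a basis of Pi does not matter. *)
Definition line_cross_ratio Pi (D : 'I_4 -> {vspace 'rV[R]_n}) : RP1 :=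
  let s (j : 'I_4) := slope (vbasis Pi)`_0%N (vbasis Pi)`_1%N (D j) in
  cross_ratio (s (inord 0)) (s (inord 1)) (s (inord 2)) (s (inord 3)).

(* For distinct hyperplanes containing a codimension 2 subspace L, that L is
   their intersection; the transverse plane Pi is immaterial and we take the
   complement of L provided by the library. *)
Definition hyperplane_cross_ratio H : RP1 :=
  let Pi := ((\bigcap_(j < 4) H j)^C)%VS in
  line_cross_ratio Pi (fun j => (H j :&: Pi)%VS).

Definition cross_ratio_map (S : 'I_4 -> set 'rV[R]_n) (x : 'rV[R]_n) : RP1_S3 :=
  S3_class (hyperplane_cross_ratio (fun j => limiting_tangent (S j) x)).

End CrossRatio.

Record branching_configuration (R : realType) (n : nat)
    (Omega Gamma : set 'rV[R]_n) (S : 'I_4 -> set 'rV[R]_n) : Prop := {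
  branch_submanifold : submanifold 2 Gamma;
  branch_medial : Gamma `<=` medial_axis Omega;
  sheet_hypersurface : forall j, submanifold 1 (S j);
  sheet_medial : forall j, S j `<=` medial_axis Omega;
  sheet_limiting_tangent :
    forall x j, Gamma x -> has_limiting_tangent (S j) x;
  branch_tangent : forall x j, Gamma x ->
    tangent_space Gamma x `<=` [set` limiting_tangent (S j) x];
  sheet_distinct : forall x, Gamma x ->
    injective (fun j => limiting_tangent (S j) x)
}.

(* Main.v *)
Require Import Defs.
From HB Require Import structures.
From mathcomp Require Import ring zify.

Set Implicit Arguments.
Unset Strict Implicit.
Unset Printing Implicit Defensive.

Local Open Scope classical_set_scope.
Local Open Scope ring_scope.

(** The cross ratio of four hyperplanes of a pencil depends only on the linear
relations between their normal covectors.  If the normals are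
[p_j X + q_j Y], [j < 4], for two covectors [X], [Y], then in any plane
transverse to the common codimension 2 subspace the slopes of the four lines
are obtained from the points [p_j : q_j] of the projective line by one and the
same projective transformation, so the cross ratio is the ratio of the
determinants [p_i q_j - p_j q_i] ([hyperplane_cross_ratio_pencil]).  An
invertible linear map acts on the covectors [X] and [Y] and leaves the
coefficients [p_j], [q_j] alone.

It remains to see that the derivative [A] of the diffeomorphism at [x] carries
the four limiting tangent hyperplanes at [x] to those at the image of [x].  At a
point [x_k] of a sheet this is the chain rule applied to curves in the sheet: a
tangent vector [v] is sent to the tangent vector [v A_k] of the image sheet
([tangent_space_map]), which for the normals [u_k] and [w_k] of the two tangent
hyperplanes says that [A_k w_k] is proportional to [u_k].  Proportionality is
the vanishing of all 2 x 2 minors, a closed condition, hence it survives when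
[x_k] tends to [x] ([limiting_tangent_map]): if [w] is normal to the limiting
hyperplane of the image sheet, [A w] is normal to that of the original one.

The four normals [A w_j] do form a pencil: the tangent space of the branching
submanifold has codimension 2 (the differential of a straightening chart maps a
coordinate subspace into it) and is contained in the four hyperplanes
([branch_normals_pencil]).

The tangent vectors being derivatives of smooth curves, the chain rule is needed
for maps of class C^k in the recursive sense of iterated directional
derivatives; it reduces to stability of C^k maps under sums and products
([Ck_on_comp]). *)

(** * Calculus of maps of class C^k *)

Section Invariance.
Context {R : realType}.
Implicit Types (V W : normedModType R).

(** Lets a formula for a derivative that holds only on an open set be
differentiated again there. *)
Lemma near_eq_differentiable V W (f g : V -> W) (x : V) :
  {near x, f =1 g} -> differentiable f x -> differentiable g x.
Proof.
move=> fg df; have [dfc fE] := (diff_locallyP x f).1 df.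
have gE : g \o shift x = cst (g x) + 'd f x +o_ 0 id.
  have fgx : f x = g x by exact: (nbhs_singleton fg).
  apply/eqaddoP => e e0.
  have fg0 : \forall y \near (0 : V), f (y + x) = g (y + x).
    by move: fg; rewrite (near_shift 0 x) /= subr0.
  have := (eqaddoP _ _ _ _).1 fE e e0.
  apply: filterS2 fg0 => y /= fgy.
  by rewrite !fctE /= fgx fgy.
apply/diff_locallyP.
have -> : 'd g x = 'd f x :> (V -> W) by exact: diff_unique.
by [].
Qed.

Lemma eq_Ck_on k V W (U : set V) (f g : V -> W) :
  open U -> (forall x, U x -> f x = g x) -> Ck_on k U f -> Ck_on k U g.
Proof.
move=> oU.
have nfg (f' g' : V -> W) x : (forall y, U y -> f' y = g' y) -> U x ->
    {near x, f' =1 g'}.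
  by move=> fg Ux; have := open_nbhs_nbhs (conj oU Ux); apply: filterS.
elim: k f g => [|k IH] f g fg /= H.
  move=> x Ux; rewrite /prop_for /continuous_at -(fg _ Ux).
  apply: cvg_trans (H x Ux).
  exact: near_eq_cvg (nfg _ _ _ fg Ux).
case: H => df Df; split=> [x Ux|v].
  exact: near_eq_differentiable (nfg _ _ _ fg Ux) (df x Ux).
apply: (IH _ _ _ (Df v)) => x Ux.
exact/near_eq_derive/nfg.
Qed.

Lemma Ck_onW k V W (U : set V) (f : V -> W) : Ck_on k.+1 U f -> Ck_on k U f.
Proof.
elim: k f => [|k IH] f [df Df] /=.
  by move=> x Ux; exact: differentiable_continuous (df x Ux).
by split=> // v; exact: IH.
Qed.

Lemma Ck_onD k V W (U : set V) (f g : V -> W) :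
  open U -> Ck_on k U f -> Ck_on k U g -> Ck_on k U (fun x => f x + g x).
Proof.
move=> oU; elim: k f g => [|k IH] f g /=.
  by move=> cf cg x Ux; apply: cvgD; [exact: cf|exact: cg].
move=> [df Df] [dg Dg]; split=> [x Ux|v].
  by apply: differentiableD; [exact: df|exact: dg].
apply: (eq_Ck_on oU _ (IH _ _ (Df v) (Dg v))) => x Ux.
by rewrite -deriveD//; apply/diff_derivable; [exact: df|exact: dg].
Qed.

Lemma Ck_on_cst k V W (U : set V) (c : W) : Ck_on k U (fun _ : V => c).
Proof.
elim: k c => [|k IH] c /=; first by move=> x _; exact: cvg_cst.
split=> [x _|v]; first exact: differentiable_cst.
have -> : (fun x : V => 'D_v (fun=> c) x) = (fun=> 0).
  by apply/funext => x; exact: derive_cst.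
exact: IH.
Qed.

Lemma Ck_on_sum k V W (U : set V) (I : Type) (s : seq I) (f : I -> V -> W) :
  open U -> (forall i, Ck_on k U (f i)) ->
  Ck_on k U (fun x => \sum_(i <- s) f i x).
Proof.
move=> oU Cf; elim: s => [|i s IH].
  under eq_fun do rewrite big_nil.
  exact: Ck_on_cst.
under eq_fun do rewrite big_cons.
exact: Ck_onD.
Qed.

Section scale.
Context {V W : normedModType R}.

Fact scale_is_bilinear :
  bilinear_for
    (GRing.Scale.Law.clone _ _ *:%R _) (GRing.Scale.Law.clone _ _ *:%R _)
    (@GRing.scale R W).
Proof.
split=> [u'|u] a x y /=.
- by rewrite scalerDl scalerA.
- by rewrite scalerDr !scalerA mulrC.
Qed.

HB.instance Definition _ :=
  bilinear_isBilinear.Build R R W W _ _ (@GRing.scale R W) scale_is_bilinear.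

Lemma is_diff_scale (a : V -> R) (f : V -> W) (x : V) :
  differentiable a x -> differentiable f x ->
  is_diff x (fun y => a y *: f y) (fun h => a x *: 'd f x h + 'd a x h *: f x).
Proof.
move=> da df.
have dp : differentiable (fun y => (a y, f y)) x by exact: differentiable_pair.
have cs : continuous (fun p : R * W => p.1 *: p.2) by exact: scale_continuous.
have ds p : differentiable (fun p : R * W => p.1 *: p.2) p.
  exact: (@differentiable_bilin _ _ _ _ (@GRing.scale R W)).
have := @differentiable_comp _ _ _ _ _ (fun p : R * W => p.1 *: p.2) _ dp (ds _).
move=> dc; apply: DiffDef => //.
have -> : (fun y => a y *: f y) =
    (fun p : R * W => p.1 *: p.2) \o (fun y => (a y, f y)) by [].
by rewrite diff_comp// (@diff_bilin _ _ _ _ (@GRing.scale R W))// diff_pair.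
Qed.

End scale.

(** The Leibniz rule expresses a derivative of the product by products of the
same kind in which one factor has lost one derivative. *)
Lemma Ck_onZ k V W (U : set V) (a : V -> R) (f : V -> W) :
  open U -> Ck_on k U a -> Ck_on k U f -> Ck_on k U (fun x => a x *: f x).
Proof.
move=> oU; elim: k a f => [|k IH] a f.
  by move=> /= ca cf x Ux; apply: cvgZ; [exact: ca|exact: cf].
move=> Ca Cf; have [da Da] := Ca; have [df Df] := Cf; split=> [x Ux|v].
  by have [] := is_diff_scale (da x Ux) (df x Ux).
apply: (eq_Ck_on oU _ (Ck_onD oU (IH _ _ (Ck_onW Ca) (Df v))
                                 (IH _ _ (Da v) (Ck_onW Cf)))) => x Ux.
have [H1 H2] := is_diff_scale (da x Ux) (df x Ux).
rewrite (deriveE _ H1) H2 !deriveE//; [exact: da|exact: df].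
Qed.

Lemma Ck_on_coord k V m n (U : set V) (f : V -> 'M[R]_(m, n)) i j :
  open U -> Ck_on k U f -> Ck_on k U (fun x => f x i j).
Proof.
move=> oU; elim: k f => [|k IH] f /=.
  move=> cf x Ux.
  exact: (@continuous_comp _ _ _ f (fun M : 'M[R]_(m, n) => M i j) x
    (cf x Ux) (@coord_continuous _ _ _ _ _ _)).
move=> [df Df]; split=> [x Ux|v].
  exact: (@differentiable_comp _ _ _ _ f (fun M : 'M[R]_(m, n) => M i j)
    _ (df x Ux) (differentiable_coord _ _ _)).
apply: (eq_Ck_on oU _ (IH _ (Df v))) => x Ux.
by rewrite derive_mx ?mxE//; exact/diff_derivable/df.
Qed.

Lemma diff_rowE n W (f : 'rV[R]_n -> W) p (v : 'rV[R]_n) :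
  differentiable f p -> 'd f p v = \sum_i v 0 i *: 'D_(delta_mx 0 i) f p.
Proof.
move=> df; rewrite [in LHS](row_sum_delta v) linear_sum.
by apply: eq_bigr => i _; rewrite linearZ deriveE.
Qed.

(** In coordinates the chain rule writes a derivative of [g \o f] as the sum of
the products of [D_v f_i] and [(D_i g) \o f]: the induction hypothesis applies
to [D_i g], and the rest is stability under sums and products. *)
Lemma Ck_on_comp k V W n (U : set V) (U' : set 'rV[R]_n)
    (f : V -> 'rV[R]_n) (g : 'rV[R]_n -> W) :
  open U -> (forall x, U x -> U' (f x)) ->
  Ck_on k U f -> Ck_on k U' g -> Ck_on k U (g \o f).
Proof.
move=> oU fU; elim: k g => [|k IH] g.
  by move=> cf cg x Ux; apply: continuous_comp; [exact: cf|exact/cg/fU].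
move=> Cf [dg Dg]; have [df Df] := Cf; split=> [x Ux|v].
  by apply: differentiable_comp; [exact: df|exact/dg/fU].
have Csum : Ck_on k U
    (fun x => \sum_i 'D_v f x 0 i *: 'D_(delta_mx 0 i) g (f x)).
  apply: Ck_on_sum => // i; apply: Ck_onZ => //.
    exact: Ck_on_coord (Df v).
  exact: (IH _ (Ck_onW Cf) (Dg _)).
apply: (eq_Ck_on oU _ Csum) => x Ux.
have dfx := df x Ux; have dgx := dg _ (fU _ Ux).
rewrite -diff_rowE// !deriveE//; last exact: differentiable_comp.
by rewrite (diff_comp dfx dgx).
Qed.

(** * Tangent vectors under diffeomorphisms *)

Lemma Ck_onS k V W (U U' : set V) (f : V -> W) :
  U' `<=` U -> Ck_on k U f -> Ck_on k U' f.
Proof.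
move=> UU'; elim: k f => [|k IH] f /=; first by move=> cf x /UU'; exact: cf.
by move=> [df Df]; split=> [x /UU'|v]; [exact: df|exact/IH/Df].
Qed.

Lemma smooth_on_affine n (U : set R) (p w : 'rV[R]_n) :
  smooth_on U (fun t : R => p + t *: w).
Proof.
have d t : is_diff t (fun t : R => p + t *: w) ( *:%R ^~ w).
  have := @is_diffD _ _ _ (cst p) (fun t : R => t *: w) _ _ t
    (is_diff_cst _ _) (is_diff_scalel _ _).
  by rewrite add0r.
move=> k; case: k => [|k].
  by move=> t _; apply: differentiable_continuous; have [] := d t.
split=> [t _|v]; first by have [] := d t.
have -> : 'D_v (fun t : R => p + t *: w) = fun=> v *: w.
  by apply/funext => t; have [d1 d2] := d t; rewrite deriveE// d2.
exact: Ck_on_cst.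
Qed.

(** The curve realizing the image of a tangent vector is [f \o gam]; as [f] is
controlled on [U] only, the interval is shrunk so that [gam] stays in [U]. *)
Lemma tangent_space_map n m (U : set 'rV[R]_n) (f : 'rV[R]_n -> 'rV[R]_m)
    (S : set 'rV[R]_n) (S' : set 'rV[R]_m) p v :
  open U -> smooth_on U f -> U p -> (forall y, S y -> U y -> S' (f y)) ->
  tangent_space S p v -> tangent_space S' (f p) (v *m jacobian f p).
Proof.
move=> oU sf Up fS [e e0 [gam [sgam Sgam gam0 dgam]]].
have I0 : `]- e, e[%classic 0 by rewrite /= in_itv /= oppr_lt0 e0.
have dgam0 : differentiable gam 0 by have [+ _] := sgam 1%N; exact.
have dfp : differentiable f p by have [+ _] := sf 1%N; exact.
have Ugam : nbhs 0 (gam @^-1` U).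
  apply: (differentiable_continuous dgam0); rewrite gam0.
  exact: open_nbhs_nbhs.
have [d /= d0 dU] := (nbhs_ballP _ _).1 Ugam.
have sub1 : `]- (Num.min e d), (Num.min e d)[%classic `<=` `]- e, e[%classic.
  move=> t /=; rewrite !in_itv /= -!ltr_norml.
  by rewrite lt_min => /andP[].
have sub2 t : `]- (Num.min e d), (Num.min e d)[%classic t -> U (gam t).
  rewrite /= in_itv /= -ltr_norml lt_min => /andP[_ td].
  by apply: dU; rewrite /ball /= sub0r normrN.
exists (Num.min e d); first by rewrite lt_min e0.
exists (f \o gam); split.
- move=> k; apply: (Ck_on_comp (U' := U)) => //.
  by apply: Ck_onS (sgam k); exact: sub1.
- by move=> t It; apply: fS; [exact/Sgam/sub1|exact: sub2].
- by rewrite /= gam0.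
- have dc : differentiable (f \o gam) 0.
    by apply: differentiable_comp => //; rewrite gam0.
  rewrite derive1E' // diff_comp ?gam0//= -dgam derive1E'//.
  by rewrite /jacobian mul_rV_lin1.
Qed.

Lemma jacobian_cancel n (f g : 'rV[R]_n -> 'rV[R]_n) x :
  differentiable f x -> differentiable g (f x) ->
  {near x, cancel f g} -> jacobian f x *m jacobian g (f x) = 1%:M.
Proof.
move=> df dg fK; apply/row_matrixP => i; rewrite !rowE mulmxA.
rewrite /jacobian !mul_rV_lin1 /= mulmx1.
rewrite -[LHS]/(('d g (f x) \o 'd f x) (delta_mx 0 i)) -diff_comp//.
rewrite -deriveE; last exact: differentiable_comp.
rewrite (@near_eq_derive _ _ _ _ id) ?derive_id//.
Qed.

Lemma diffeomorphism_differentiable V W (U : set V) (U' : set W) (f : V -> W) x :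
  diffeomorphism U U' f -> U x -> differentiable f x.
Proof. by move=> [_ _ sf _] Ux; have [+ _] := sf 1%N; exact. Qed.

Lemma diffeomorphism_jacobian n (U U' : set 'rV[R]_n) f x :
  diffeomorphism U U' f -> U x -> jacobian f x \in unitmx.
Proof.
move=> df Ux; have dfx := diffeomorphism_differentiable df Ux.
case: df => oU oU' sf [g [sg fK gK]].
have dgx : differentiable g (f x).
  by have [+ _] := sg 1%N; apply; exact: (fK _ Ux).1.
apply: (mulmx1_unit (jacobian_cancel dfx dgx _)).1.
have := open_nbhs_nbhs (conj oU Ux); apply: filterS => y Uy.
exact: (fK _ Uy).2.
Qed.

(** The inverse of a straightening chart maps the segments parallel to the first
[n - c] coordinate axes to curves in the submanifold.  With [c] zeros at the end
of [w], the image of the linear injection [w |-> w *m B] has codimension [c]. *)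
Lemma submanifold_tangent n c (S : set 'rV[R]_n) x :
  submanifold c S -> S x -> exists2 B, B \in unitmx &
    forall w : 'rV[R]_n, (forall i : 'I_n, (n - c <= i)%N -> w 0 i = 0) ->
      tangent_space S x (w *m B).
Proof.
move=> mS Sx; have [U [V [h [Ux [oU oV sh [g [sg hK gK]]] SE]]]] := mS x Sx.
have [Vhx ghx] := hK _ Ux.
have dg : diffeomorphism V U g by split=> //; exists h.
exists (jacobian g (h x)); first exact: diffeomorphism_jacobian dg Vhx.
move=> w w0; rewrite -[X in tangent_space _ X]ghx.
pose P := [set y : 'rV[R]_n | forall i : 'I_n, (n - c <= i)%N -> y 0 i = 0].
apply: (tangent_space_map (U := V) (S := P)) => //.
  move=> y Py Vy; have [Ugy hgy] := gK _ Vy.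
  by apply/(SE _ Ugy); rewrite hgy.
exists 1 => //; exists (fun t => h x + t *: w); split.
- exact: smooth_on_affine.
- by move=> t _ i ci; rewrite !mxE w0// mulr0 addr0; apply: (SE _ Ux).1.
- by rewrite scale0r addr0.
- rewrite derive1E' ?deriveE; last first.
    by have [+ _] := @smooth_on_affine n [set: R] (h x) w 1%N; exact.
  have := @is_diffD _ _ _ (cst (h x)) (fun t : R => t *: w) _ _ 0
    (is_diff_cst _ _) (is_diff_scalel _ _).
  by rewrite add0r => -[_ ->]; rewrite scale1r.
Qed.

(** * Limiting tangent hyperplanes *)

Lemma closure_seq V (S U : set V) x : closure S x -> nbhs x U ->
  exists2 x_ : nat -> V, (forall k, S (x_ k) /\ U (x_ k)) & x_ k @[k --> \oo] --> x.
Proof.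
move=> Sx Ux.
have H k : exists y, (S y /\ U y) /\ ball x k.+1%:R^-1 y.
  have : nbhs x (U `&` ball x k.+1%:R^-1).
    by apply: filterI => //; apply: nbhsx_ballx.
  by move=> /Sx[y [Sy [Uy xy]]]; exists y.
have [x_ x_P] := choice H; exists x_; first by move=> k; have [] := x_P k.
apply/cvg_ballP => e e0; near=> k.
apply: le_ball (x_P k).2.
by near: k; apply: filterS (near_infty_natSinv_lt (PosNum e0)) => k' /ltW.
Unshelve. all: by end_near. Qed.


Lemma normal_toZ n (H : set 'rV[R]_n) u c :
  c != 0 -> normal_to H u -> normal_to H (c *: u).
Proof.
move=> c0 [u0 ->]; split; first by rewrite scaler_eq0 negb_or c0.
apply/seteqP; split => v /=; rewrite -scalemxAr; first by move=> ->; rewrite scaler0.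
by move=> /eqP; rewrite scaler_eq0 (negbTE c0) => /eqP.
Qed.

(** Inclusion of kernels means proportionality of covectors.  Stating it with
2 x 2 minors instead of a factor gives equations which pass to the limit
without any control of the factors. *)
Lemma kernel_subset_minors n (u a : 'cV[R]_n) :
  (forall v : 'rV[R]_n, v *m u = 0 -> v *m a = 0) ->
  forall i j, a i 0 * u j 0 = a j 0 * u i 0.
Proof.
move=> ua i j.
(* This vector is killed by [u], whatever [u] is. *)
pose v := u j 0 *: delta_mx 0 i - u i 0 *: delta_mx 0 j : 'rV[R]_n.
have vE (b : 'cV[R]_n) : v *m b = (u j 0 * b i 0 - u i 0 * b j 0)%:M.
  apply/rowP => l; rewrite mulmxBl -!scalemxAl -!rowE !mxE !ord1 /=.
  by rewrite mulr1n.
have : v *m a = 0 by apply: ua; rewrite vE mulrC subrr raddf0.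
rewrite vE => /matrixP/(_ 0 0); rewrite !mxE /= mulr1n => /eqP.
by rewrite subr_eq0 mulrC => /eqP ->; rewrite mulrC.
Qed.

Lemma minors_proportional n (u a : 'cV[R]_n) :
  u != 0 -> (forall i j, a i 0 * u j 0 = a j 0 * u i 0) ->
  exists c, a = c *: u.
Proof.
move=> u0 au; have [j uj] : exists j, u j 0 != 0.
  apply/existsP; apply: contraNT u0; rewrite negb_exists => /forallP u0.
  apply/eqP/colP => j; rewrite mxE; apply/eqP; move: (u0 j).
  by rewrite negbK.
exists (a j 0 / u j 0); apply/colP => i; rewrite !mxE.
by apply: (mulIf uj); rewrite au mulrAC divfK.
Qed.

Lemma cvg_mulmx_col n (A_ : nat -> 'M[R]_n) (w_ : nat -> 'cV[R]_n)
    (A : 'M[R]_n) (w : 'cV[R]_n) :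
  (forall i j, A_ k i j @[k --> \oo] --> A i j) -> w_ k @[k --> \oo] --> w ->
  forall i, (A_ k *m w_ k) i 0 @[k --> \oo] --> (A *m w) i 0.
Proof.
move=> cA cw i; rewrite mxE; under eq_fun do rewrite mxE.
elim: (index_enum _) => [|j s IH].
  by rewrite big_nil; under eq_fun do rewrite big_nil; exact: cvg_cst.
rewrite big_cons.
under [X in X @ _]eq_fun do rewrite big_cons.
apply: cvgD => //; apply: cvgM => //.
exact: (continuous_cvg _ (@coord_continuous _ _ _ j 0 w) cw).
Qed.

(** The rows of the Jacobian matrix are the partial derivatives, which are
continuous on [U]. *)
Lemma smooth_jacobian_cvg n (U : set 'rV[R]_n) (f : 'rV[R]_n -> 'rV[R]_n)
    (x_ : nat -> 'rV[R]_n) x :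
  smooth_on U f -> U x -> (forall k, U (x_ k)) -> x_ k @[k --> \oo] --> x ->
  forall i j, jacobian f (x_ k) i j @[k --> \oo] --> jacobian f x i j.
Proof.
move=> sf Ux Ux_ cx i j; have [df Df] := sf 1%N.
have E y : U y -> jacobian f y i j = 'D_(delta_mx 0 i) f y 0 j.
  by move=> Uy; rewrite (deriveEjacobian _ (df y Uy)) -rowE [RHS]mxE.
set g := 'D_(delta_mx 0 i) f in E.
have cg : g (x_ k) @[k --> \oo] --> g x by exact: (continuous_cvg _ (Df _ _ Ux) cx).
have cgj : g (x_ k) 0 j @[k --> \oo] --> g x 0 j.
  exact: (continuous_cvg _ (@coord_continuous _ _ _ 0 j (g x)) cg).
have Ek : (fun k => g (x_ k) 0 j) = (fun k => jacobian f (x_ k) i j).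
  by apply/funext => k; rewrite E.
by move: cgj; rewrite Ek -E.
Qed.

Lemma limiting_tangentP n (S : set 'rV[R]_n) x :
  has_limiting_tangent S x -> is_limiting_tangent S x (limiting_tangent S x).
Proof. by move=> [_ [H [HH _]]]; by apply: xgetPex; exists H. Qed.

(** The limiting tangent hyperplanes correspond under the derivative of [f],
expressed by normals: vectors being rows, [v |-> v *m J] is the derivative and
[w |-> J *m w] its transpose on covectors. *)
Lemma limiting_tangent_map n (U U' : set 'rV[R]_n) f (S S' : set 'rV[R]_n) x :
  diffeomorphism U U' f -> U x -> (forall y, S y -> U y -> S' (f y)) ->
  has_limiting_tangent S x -> has_limiting_tangent S' (f x) ->
  exists2 w, normal_to [set` limiting_tangent S' (f x)] w &
             normal_to [set` limiting_tangent S x] (jacobian f x *m w).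
Proof.
move=> df Ux fS hS hS'.
have [oU oU' sf _] := df; have uJ := diffeomorphism_jacobian df.
have [x_ x_P cx] := closure_seq hS.1 (open_nbhs_nbhs (conj oU Ux)).
have Sx_ k : S (x_ k) by have [] := x_P k.
have Ux_ k : U (x_ k) by have [] := x_P k.
have [u_ [u [nu_ nu cu]]] := limiting_tangentP hS Sx_ cx.
have cfx : f (x_ k) @[k --> \oo] --> f x.
  exact: (continuous_cvg _ (sf 0%N x Ux) cx).
have [w_ [w [nw_ nw cw]]] :=
  limiting_tangentP hS' (fun k => fS _ (Sx_ k) (Ux_ k)) cfx.
exists w => //.
have minors i j : (jacobian f x *m w) i 0 * u j 0 = (jacobian f x *m w) j 0 * u i 0.
  have cJ := cvg_mulmx_col (smooth_jacobian_cvg sf Ux Ux_ cx) cw.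
  have ce l : u_ k l 0 @[k --> \oo] --> u l 0.
    exact: (continuous_cvg _ (@coord_continuous _ _ _ l 0 u) cu).
  have E : (fun k => (jacobian f (x_ k) *m w_ k) i 0 * u_ k j 0) =
      (fun k => (jacobian f (x_ k) *m w_ k) j 0 * u_ k i 0).
    apply/funext => k; apply: kernel_subset_minors => v vu.
    have Tv : tangent_space S (x_ k) v by have [_ ->] := nu_ k.
    have := tangent_space_map oU sf (Ux_ k) fS Tv.
    by have [_ ->] := nw_ k; rewrite /= mulmxA.
  have L1 := cvgM (cJ i) (ce j); have L2 := cvgM (cJ j) (ce i).
  rewrite -[_ \* _]/(fun k => (jacobian f (x_ k) *m w_ k) i 0 * u_ k j 0) E in L1.
  exact: (cvg_unique (@norm_hausdorff _ _) (L1 _) (L2 _)).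
have [u0 _] := nu; have [w0 _] := nw.
have [c Jw] := minors_proportional u0 minors.
(* [w] is nonzero and the Jacobian matrix is invertible. *)
have c0 : c != 0.
  apply: contraNneq w0 => c0; move: Jw; rewrite c0 scale0r => Jw.
  by rewrite -(mulKmx (uJ _ Ux) w) Jw mulmx0.
by rewrite Jw; exact: normal_toZ.
Qed.

(** * Cross ratio of four hyperplanes of a pencil *)

Definition bracket (p q : 'I_4 -> R) (i j : 'I_4) : R := p i * q j - p j * q i.

Definition bracket_ratio (p q : 'I_4 -> R) : R :=
  let br (i j : nat) := bracket p q (inord i) (inord j) in
  (br 0%N 3%N * br 2%N 1%N) / (br 0%N 1%N * br 2%N 3%N).

(** The line [a x + b y = 0] of the plane is the point [- a / b] of the projective
line, its slope. *)
Definition affine_point (a b : R) : @RP1 R :=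
  if b == 0 then None else Some (- a / b).

(** Each index occurs once in the numerator and once in the denominator of
[bracket_ratio], so that replacing a finite point [- p_j / q_j] by its
homogeneous coordinates cancels the denominators; when some [q_j] is zero, the
two occurrences of [p_j] cancel instead.  Nonzero brackets allow at most one
[q_j] to vanish. *)
Lemma cross_ratio_affine_point (p q : 'I_4 -> R) :
  (forall i j, i != j -> bracket p q i j != 0) ->
  let z (i : nat) := affine_point (p (inord i)) (q (inord i)) in
  cross_ratio (z 0%N) (z 1%N) (z 2%N) (z 3%N) = Some (bracket_ratio p q).
Proof.
move=> br0; rewrite /bracket_ratio /bracket /affine_point /=.
have br (i j : nat) : (i < 4)%N -> (j < 4)%N -> i != j ->
    p (inord i) * q (inord j) - p (inord j) * q (inord i) != 0.
  move=> i4 j4 ij; apply: br0; apply: contra ij => /eqP/(congr1 val) /=.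
  by rewrite !inordK// => ->.
have := br 0%N 1%N erefl erefl erefl; have := br 0%N 2%N erefl erefl erefl.
have := br 0%N 3%N erefl erefl erefl; have := br 1%N 2%N erefl erefl erefl.
have := br 1%N 3%N erefl erefl erefl; have := br 2%N 3%N erefl erefl erefl.
have := br 2%N 1%N erefl erefl erefl.
move: (p (inord 0)) (p (inord 1)) (p (inord 2)) (p (inord 3)).
move: (q (inord 0)) (q (inord 1)) (q (inord 2)) (q (inord 3)).
move=> {br0 br p q} q0 q1 q2 q3 p0 p1 p2 p3 h21 h23 h13 h12 h03 h02 h01.
have nz (a b c d : R) : b = 0 -> d = 0 -> a * d - c * b != 0 -> False.
  by move=> -> ->; rewrite !mulr0 subrr eqxx.
have opp (a b c d : R) : a * b - c * d != 0 -> - a * b + - - c * d != 0.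
  by move=> h; rewrite opprK mulNr addrC -opprB oppr_eq0.
have pl (a b c : R) : a * b - c * 0 != 0 -> a != 0.
  by apply: contraNneq => ->; rewrite mul0r mulr0 subrr.
have pr (a b c : R) : c * 0 - a * b != 0 -> a != 0.
  by apply: contraNneq => ->; rewrite mul0r mulr0 subrr.
case: (eqVneq q0 0) => e0; case: (eqVneq q1 0) => e1;
case: (eqVneq q2 0) => e2; case: (eqVneq q3 0) => e3 /=;
try by [case: (nz _ _ _ _ e0 e1 h01)|case: (nz _ _ _ _ e0 e2 h02)
  |case: (nz _ _ _ _ e0 e3 h03)|case: (nz _ _ _ _ e1 e2 h12)
  |case: (nz _ _ _ _ e1 e3 h13)|case: (nz _ _ _ _ e2 e3 h23)].
all: congr Some; subst.
all: rewrite ?mulr0 ?subr0 ?sub0r; field.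
all: repeat (apply/andP; split); first
  [done|by apply: opp|exact: (pl _ _ _ h01)|exact: (pl _ _ _ h23)
  |exact: (pr _ _ _ h01)|exact: (pr _ _ _ h23)].
Qed.

Lemma hyperplane_eq n (H H' : set 'rV[R]_n) u u' :
  normal_to H u -> normal_to H' u' -> H `<=` H' -> H = H'.
Proof.
move=> nu [u'0 H'E] HH'; have [u0 HE] := nu.
have [|c uE] := minors_proportional (a := u') u0.
  apply: kernel_subset_minors => v vu.
  by have : H' v by [apply: HH'; rewrite HE]; rewrite H'E.
have c0 : c != 0 by apply: contraNneq u'0 => c0; rewrite uE c0 scale0r.
by have [_ ->] := normal_toZ c0 nu; rewrite -uE.
Qed.

Lemma free_pair n (e1 e2 : 'rV[R]_n) b (s t : R) :
  free [:: e1, e2 & b] -> s *: e1 + t *: e2 = 0 -> s = 0 /\ t = 0.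
Proof.
rewrite !free_cons => /and3P[e1b e2b _] st0.
have s0 : s = 0.
  apply: contraNeq e1b => s0.
  have -> : e1 = - (t / s) *: e2.
    apply: (scalerI s0); rewrite scalerA mulrN mulrCA divff// mulr1.
    by rewrite scaleNr; apply/eqP; rewrite -addr_eq0 st0.
  by apply/rpredZ/memv_span; rewrite inE eqxx.
split=> //; move: st0; rewrite s0 scale0r add0r => /eqP.
rewrite scaler_eq0 => /orP[/eqP //|/eqP e20].
by move: e2b; rewrite e20 mem0v.
Qed.


Definition pairing n (v : 'rV[R]_n) (u : 'cV[R]_n) : R := (v *m u) 0 0.

Lemma pairing_lin n s t (v v' : 'rV[R]_n) u :
  pairing (s *: v + t *: v') u = s * pairing v u + t * pairing v' u.
Proof. by rewrite /pairing mulmxDl -!scalemxAl !mxE. Qed.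

Lemma pairing_linr n s t (v : 'rV[R]_n) u u' :
  pairing v (s *: u + t *: u') = s * pairing v u + t * pairing v u'.
Proof. by rewrite /pairing mulmxDr -!scalemxAr !mxE. Qed.

Lemma mem_hyperplane n (H : {vspace 'rV[R]_n}) u v :
  normal_to [set` H] u -> (v \in H) = (pairing v u == 0).
Proof.
move=> [_ HE]; have vH : v \in H <-> v *m u = 0.
  by have : [set` H] v <-> [set v | v *m u = 0] v by rewrite HE.
apply/idP/eqP => [/vH vu|vu]; first by rewrite /pairing vu mxE.
by apply/vH/rowP => i; rewrite !ord1 [RHS]mxE.
Qed.

Lemma vspace_set_inj n (H H' : {vspace 'rV[R]_n}) :
  [set` H] = [set` H'] -> H = H'.
Proof.
move=> HE; apply/vspaceP => v; have := congr1 (fun A => A v) HE.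
by rewrite propeqE => -[h h']; apply/idP/idP.
Qed.

(** In the basis [e1], [e2] the line cut out by the covector [u] has the equation
whose coefficients are the values of [u] on the basis. *)
Lemma slope_hyperplane n (H Pi : {vspace 'rV[R]_n}) u e1 e2 :
  normal_to [set` H] u -> e1 \in Pi -> e2 \in Pi ->
  slope e1 e2 (H :&: Pi)%VS = affine_point (pairing e1 u) (pairing e2 u).
Proof.
move=> nu Pi1 Pi2; rewrite /slope /affine_point memv_cap Pi2 andbT.
rewrite (mem_hyperplane _ nu); case: eqVneq => // e2u; congr Some.
have memE a : e1 + a *: e2 \in (H :&: Pi)%VS = (a == - pairing e1 u / pairing e2 u).
  rewrite memv_cap (mem_hyperplane _ nu) rpredD ?rpredZ// andbT.
  rewrite -[e1 in e1 + _]scale1r pairing_lin mul1r.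
  by rewrite addrC addr_eq0 -[RHS](inj_eq (mulIf e2u)) divfK.
case: xgetP => [a _ /=|/(_ (- pairing e1 u / pairing e2 u))]; rewrite ?memE.
  by move/eqP.
by rewrite /= memE eqxx => /(_ isT).
Qed.

(** A vanishing bracket would make the two normals proportional. *)
Lemma bracket_neq0 n (H : 'I_4 -> {vspace 'rV[R]_n}) p q X Y i j :
  (forall j, normal_to [set` H j] (p j *: X + q j *: Y)) -> injective H ->
  i != j -> bracket p q i j != 0.
Proof.
move=> nH injH; apply: contra => /eqP br0; apply/eqP/injH/vspace_set_inj.
apply: (hyperplane_eq (nH i) (nH j)) => w /=.
rewrite (mem_hyperplane _ (nH i)) (mem_hyperplane _ (nH j)) !pairing_linr => /eqP wi.
move: (pairing w X) (pairing w Y) wi => x y wi.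
have pj : p i * (p j * x + q j * y) = 0.
  have -> : p i * (p j * x + q j * y) =
      p j * (p i * x + q i * y) + bracket p q i j * y by rewrite /bracket; ring.
  by rewrite wi br0 mulr0 mul0r addr0.
have qj : q i * (p j * x + q j * y) = 0.
  have -> : q i * (p j * x + q j * y) =
      q j * (p i * x + q i * y) - bracket p q i j * x by rewrite /bracket; ring.
  by rewrite wi br0 mulr0 mul0r subr0.
have [ui0 _] := nH i; apply: contraNT ui0 => wj.
move: pj qj => /eqP + /eqP; rewrite !mulf_eq0 (negbTE wj) !orbF.
by move=> /eqP -> /eqP ->; rewrite !scale0r addr0.
Qed.

Lemma bigcap_pencil n (H : 'I_4 -> {vspace 'rV[R]_n}) p q X Y v :
  (forall j, normal_to [set` H j] (p j *: X + q j *: Y)) ->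
  pairing v X = 0 -> pairing v Y = 0 -> v \in (\bigcap_(j < 4) H j)%VS.
Proof.
move=> nH vX vY; rewrite memvE; apply/subv_bigcapP => j _.
by rewrite -memvE (mem_hyperplane _ (nH j)) pairing_linr vX vY !mulr0 addr0.
Qed.

(** The intersection [L] is strictly smaller than [H_0], itself strictly smaller
than the whole space.  A bound is enough: the cross ratio is computed with the
first two vectors of a basis of the complement of [L]. *)
Lemma dim_compl_bigcap n (H : 'I_4 -> {vspace 'rV[R]_n}) (u : 'I_4 -> 'cV[R]_n) :
  (forall j, normal_to [set` H j] (u j)) -> injective H ->
  (2 <= \dim (\bigcap_(j < 4) H j)^C)%N.
Proof.
move=> nH injH; set L := (\bigcap_(j < 4) H j)%VS.
have proper (U V : {vspace 'rV[R]_n}) : (U <= V)%VS -> U != V -> (\dim U < \dim V)%N.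
  by move=> UV; rewrite (ltn_leqif (dimv_leqif_eq UV)).
have LH j : (L <= H j)%VS by have /subv_bigcapP := subvv L; exact.
have L0 : (\dim L < \dim (H (inord 0)))%N.
  apply: proper => //; apply/eqP => LE.
  have /injH/(congr1 val) : H (inord 0) = H (inord 1).
    apply/vspace_set_inj/(hyperplane_eq (nH _) (nH _)) => v /=.
    by rewrite -LE; exact/subvP.
  by rewrite /= !inordK.
have H0 : (\dim (H (inord 0)) < \dim {:'rV[R]_n})%N.
  apply: proper; first exact: subvf.
  apply/eqP => HE; have [+ _] := nH (inord 0).
  case/eqP; apply/row_matrixP => i; rewrite rowE row0; apply/rowP => j.
  rewrite !ord1 [RHS]mxE; apply/eqP.
  by rewrite -/(pairing _ _) -(mem_hyperplane _ (nH _)) HE memvf.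
by rewrite dimv_compl ltn_subRL addn1; exact: leq_trans H0.
Qed.

(** Evaluating the covectors [p_j X + q_j Y] on two vectors [e1], [e2] multiplies
all the brackets by the determinant of the values of [X], [Y] on [e1], [e2], and
[bracket_ratio] is homogeneous of degree zero in the brackets. *)
Lemma hyperplane_cross_ratio_pencil n (H : 'I_4 -> {vspace 'rV[R]_n}) p q X Y :
  (forall j, normal_to [set` H j] (p j *: X + q j *: Y)) -> injective H ->
  hyperplane_cross_ratio H = Some (bracket_ratio p q).
Proof.
move=> nH injH; rewrite /hyperplane_cross_ratio /line_cross_ratio.
have dPi := dim_compl_bigcap nH injH.
set L := (\bigcap_(j < 4) H j)%VS in dPi *; set Pi := (L^C)%VS in dPi *.
have := basis_free (vbasisP Pi); have := size_tuple (vbasis Pi).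
have memPi (e : 'rV[R]_n) : e \in tval (vbasis Pi) -> e \in Pi by exact: vbasis_mem.
case: (tval (vbasis Pi)) memPi => [|e1 [|e2 b]] memPi.
- by move=> /= E; rewrite -E in dPi.
- by move=> /= E; rewrite -E in dPi.
move=> _ fr /=.
have Pi1 : e1 \in Pi by apply: memPi; rewrite inE eqxx.
have Pi2 : e2 \in Pi by apply: memPi; rewrite !inE eqxx orbT.
have LPi v : v \in Pi -> pairing v X = 0 -> pairing v Y = 0 -> v = 0.
  move=> vPi vX vY; apply/eqP; rewrite -memv0 -(capv_compl L) memv_cap vPi andbT.
  exact: bigcap_pencil nH vX vY.
(* If the determinant vanished, the combinations of [e1] and [e2] with
   coefficients [(X e2, - X e1)] and [(Y e2, - Y e1)] would be killed by [X] and
   [Y], so all these coefficients would be zero; then [X] and [Y] kill [e1]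
   itself, which is not zero. *)
have det0 : pairing e1 X * pairing e2 Y - pairing e2 X * pairing e1 Y != 0.
  apply/eqP => det0.
  have k0 s t : s * pairing e1 X + t * pairing e2 X = 0 ->
      s * pairing e1 Y + t * pairing e2 Y = 0 -> s = 0 /\ t = 0.
    move=> kX kY; apply: (free_pair fr); apply: LPi; rewrite ?pairing_lin//.
    by rewrite rpredD// rpredZ.
  have [X2 X1] : pairing e2 X = 0 /\ - pairing e1 X = 0.
    by apply: k0; [ring|rewrite -[RHS]oppr0 -det0; ring].
  have [Y2 Y1] : pairing e2 Y = 0 /\ - pairing e1 Y = 0.
    by apply: k0; [rewrite -det0; ring|ring].
  have [/eqP] : (1 : R) = 0 /\ (0 : R) = 0.
    by apply: k0; rewrite ?X2 ?Y2 mul1r mulr0 addr0; apply: oppr_inj; rewrite ?X1 ?Y1 oppr0.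
  by rewrite oner_eq0.
pose P j := pairing e1 (p j *: X + q j *: Y).
pose Q j := pairing e2 (p j *: X + q j *: Y).
have brPQ i j : bracket P Q i j =
    bracket p q i j * (pairing e1 X * pairing e2 Y - pairing e2 X * pairing e1 Y).
  by rewrite /bracket /P /Q !pairing_linr; ring.
rewrite !(slope_hyperplane (nH _) Pi1 Pi2).
have := @cross_ratio_affine_point P Q; rewrite /= => ->; last first.
  by move=> i j ij; rewrite brPQ mulf_neq0// (bracket_neq0 nH).
congr Some; rewrite /bracket_ratio !brPQ.
have br01 : bracket p q (inord 0) (inord 1) != 0.
  apply: (bracket_neq0 nH) => //; apply/eqP => /(congr1 val) /=.
  by rewrite !inordK.
have br23 : bracket p q (inord 2) (inord 3) != 0.
  apply: (bracket_neq0 nH) => //; apply/eqP => /(congr1 val) /=.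
  by rewrite !inordK.
by field; rewrite br01 br23 det0.
Qed.

(** Transported by the matrix [B] of a chart, the normals vanish on the first
[n - 2] coordinate vectors, hence are combinations of the last two coordinate
covectors. *)
Lemma branch_normals_pencil n (hn : (2 <= n)%N) (G : set 'rV[R]_n)
    x (I : Type) (H : I -> {vspace 'rV[R]_n}) (u : I -> 'cV[R]_n) :
  submanifold 2 G -> G x -> (forall j, normal_to [set` H j] (u j)) ->
  (forall j, tangent_space G x `<=` [set` H j]) ->
  exists p q X Y, forall j, u j = p j *: X + q j *: Y.
Proof.
move=> mG Gx nH GH; have [B uB BT] := submanifold_tangent mG Gx.
have i0n : (n - 2 < n)%N by rewrite ltn_subrL (leq_trans _ hn).
have i1n : (n - 1 < n)%N by rewrite ltn_subrL (leq_trans _ hn).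
pose i0 := Ordinal i0n; pose i1 := Ordinal i1n.
exists (fun j => (B *m u j) i0 0), (fun j => (B *m u j) i1 0).
exists (invmx B *m delta_mx i0 0), (invmx B *m delta_mx i1 0) => j.
rewrite !scalemxAr -mulmxDr -[LHS](mulKmx uB); congr (_ *m _).
have m0 (i : 'I_n) : (i < n - 2)%N -> (B *m u j) i 0 = 0.
  move=> i2; have : [set` H j] (delta_mx 0 i *m B).
    apply/GH/BT => k nk; rewrite mxE eqxx /=; case: eqVneq => // ki.
    by move: nk; rewrite ki leqNgt i2.
  have [_ ->] := nH j; rewrite /= -mulmxA -rowE => /rowP/(_ 0).
  by rewrite [LHS]mxE [RHS]mxE.
move: (B *m u j) m0 => m m0; apply/colP => i; rewrite !mxE eqxx !andbT.
have [i2|i2] := ltnP i (n - 2).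
  rewrite (m0 i)//; have -> : (i == i0) = false by rewrite -val_eqE /=; lia.
  have -> : (i == i1) = false by rewrite -val_eqE /=; lia.
  by rewrite !mulr0 addr0.
have : (i == i0) || (i == i1).
  by rewrite -!val_eqE /=; move: (ltn_ord i) i2 hn; lia.
have i01 : (i0 == i1) = false by rewrite -val_eqE /=; lia.
case/orP => /eqP ->; first by rewrite eqxx i01 mulr1 mulr0 addr0.
by rewrite (eq_sym i1) i01 eqxx mulr1 mulr0 add0r.
Qed.

End Invariance.

(** * Invariance under diffeomorphisms *)

Theorem theorem4p1 (R : realType) (n : nat) (hn : (2 <= n)%N)
  (Omega1 Omega2 : set 'rV[R]_n)
  (hOmega1 : region Omega1) (hOmega2 : region Omega2)
  (Gamma1 Gamma2 : set 'rV[R]_n) (S1 S2 : 'I_4 -> set 'rV[R]_n)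
  (hB1 : branching_configuration Omega1 Gamma1 S1)
  (hB2 : branching_configuration Omega2 Gamma2 S2)
  (U1 U2 : set 'rV[R]_n) (hU1 : Gamma1 `<=` U1) (hU2 : Gamma2 `<=` U2)
  (phi : 'rV[R]_n -> 'rV[R]_n) (hphi : diffeomorphism U1 U2 phi)
  (hGamma : phi @` Gamma1 = Gamma2)
  (hS : forall j : 'I_4, phi @` (S1 j `&` U1) = S2 j `&` U2) :
  forall x, Gamma1 x -> cross_ratio_map S2 (phi x) = cross_ratio_map S1 x.
Proof.
move=> x Gx; have Ux := hU1 _ Gx.
have Gphix : Gamma2 (phi x) by rewrite -hGamma; exists x.
have uA := diffeomorphism_jacobian hphi Ux.
set A := jacobian phi x in uA.
have /choice[w wP] : forall j, exists w,
    normal_to [set` limiting_tangent (S2 j) (phi x)] w /\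
    normal_to [set` limiting_tangent (S1 j) x] (A *m w).
  move=> j.
  have phiS y : S1 j y -> U1 y -> S2 j (phi y).
    move=> Sy Uy; have : (S2 j `&` U2) (phi y) by rewrite -hS; exists y.
    by case.
  have [w w2 w1] := limiting_tangent_map hphi Ux phiS
    (sheet_limiting_tangent hB1 j Gx) (sheet_limiting_tangent hB2 j Gphix).
  by exists w.
have [p [q [X [Y pencil]]]] := branch_normals_pencil hn
  (branch_submanifold hB1) Gx (fun j => (wP j).2)
  (fun j => @branch_tangent _ _ _ _ _ hB1 x j Gx).
(* The coefficients [p], [q] serve at both points; only the covectors spanning
   the pencil change, from [X], [Y] to their preimages under [A]. *)
rewrite /cross_ratio_map; congr S3_class.
rewrite (hyperplane_cross_ratio_pencil (p := p) (q := q)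
  (X := invmx A *m X) (Y := invmx A *m Y) _ (sheet_distinct hB2 Gphix)).
  rewrite (hyperplane_cross_ratio_pencil (p := p) (q := q) (X := X) (Y := Y) _
    (sheet_distinct hB1 Gx))//.
  by move=> j; rewrite -pencil; exact: (wP j).2.
move=> j; rewrite !scalemxAr -mulmxDr -pencil mulKmx//; exact: (wP j).1.
Qed.
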